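(* Let $\boldsymbol{V}\in\mathbb{R}^{n\times p}$ have full column rank $p<n$, let $\boldsymbol{A}\in\mathbb{R}^{n\times n}$ be a symmetric matrix of full rank $n$, and let $\boldsymbol{L}_\varepsilon=\varepsilon\boldsymbol{A}+\boldsymbol{V}\boldsymbol{V}^\top$, assumed positive semi-definite for all sufficiently small $\varepsilon>0$. Let $1\le m\le n$ and let $\mathcal{X}_\varepsilon\sim|DPP|_m(\boldsymbol{L}_\varepsilon)$. Then, as $\varepsilon\to0$ ($\varepsilon>0$), $\mathcal{X}_\varepsilon$ converges to $\mathcal{X}_\star$, where $$\mathcal{X}_\star\sim\begin{cases}|DPP|_m(\boldsymbol{V}\boldsymbol{V}^\top),& m\le p,\\ |DPP|_m(\boldsymbol{A};\boldsymbol{V}),& m>p.\end{cases}$$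
   Context: The ground set is $\Omega\cong\{1,\dots,n\}$. $\boldsymbol{M}_X$ denotes the submatrix with rows and columns in $X$, $\boldsymbol{M}_{X,:}$ the submatrix of rows in $X$. Fixed-size L-ensemble: for $\boldsymbol{L}$ positive semi-definite, $\mathcal{X}\sim|DPP|_m(\boldsymbol{L})$ means $\mathbf{P}(\mathcal{X}=X)\propto\det(\boldsymbol{L}_X)$ if $|X|=m$, and $0$ otherwise. Fixed-size partial-projection DPP: for $\boldsymbol{L}$ symmetric and $\boldsymbol{V}\in\mathbb{R}^{n\times p}$ of full column rank such that $\boldsymbol{x}^\top\boldsymbol{L}\boldsymbol{x}\ge0$ whenever $\boldsymbol{V}^\top\boldsymbol{x}=0$ (a ''nonnegative pair''), $\mathcal{X}\sim|DPP|_m(\boldsymbol{L};\boldsymbol{V})$ means $$\mathbf{P}(\mathcal{X}=X)\propto(-1)^p\det\begin{pmatrix}\boldsymbol{L}_X&\boldsymbol{V}_{X,:}\\(\boldsymbol{V}_{X,:})^\top&\boldsymbol{0}\end{pmatrix}\ \text{ if }|X|=m,$$ and $0$ otherwise. Convergence: $\mathcal{X}_\varepsilon$ converges to $\mathcal{X}_\star$ if $\mathbf{P}(\mathcal{X}_\varepsilon=X)\to\mathbf{P}(\mathcal{X}_\star=X)$ for every $X\subseteq\Omega$. *)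

(* Defs.v *)
From HB Require Import structures.
From mathcomp Require Import all_boot all_order all_algebra.
From mathcomp Require Import all_classical all_reals all_analysis.
Set Implicit Arguments.
Unset Strict Implicit.
Unset Printing Implicit Defensive.
Import Order.TTheory GRing.Theory Num.Theory.
Import numFieldNormedType.Exports.
Local Open Scope classical_set_scope.
Local Open Scope ring_scope.

(* Each random subset carries its own probability space, since only laws
   matter for convergence. *)
Record random_subset (R : realType) (n : nat) := RandomSubset {
  rs_display : measure_display ;
  rs_space : measurableType rs_display ;
  rs_prob : probability rs_space R ;
  rs_fun :> rs_space -> {set 'I_n} ;
  rs_measurable : forall S : {set 'I_n}, measurable (rs_fun @^-1` [set S]) }.

(* P(X = S) *)
Definition pr_eq (R : realType) (n : nat) (X : random_subset R n)
    (S : {set 'I_n}) : R :=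
  fine (rs_prob X (X @^-1` [set S])).

Definition converges_in_law (R : realType) (n : nat)
    (X : R -> random_subset R n) (Xstar : random_subset R n) : Prop :=
  forall S : {set 'I_n}, pr_eq (X e) S @[e --> 0^'+] --> pr_eq Xstar S.

(* M_S and M_{S,:}, with the elements of S listed in increasing order *)
Definition principal_submx (R : realType) (n : nat) (S : {set 'I_n})
    (M : 'M[R]_n) : 'M[R]_#|S| :=
  mxsub (@enum_val _ (mem S)) (@enum_val _ (mem S)) M.

Definition row_submx (R : realType) (n p : nat) (S : {set 'I_n})
    (M : 'M[R]_(n, p)) : 'M[R]_(#|S|, p) :=
  rowsub (@enum_val _ (mem S)) M.

Definition psd (R : realType) (n : nat) (L : 'M[R]_n) : Prop :=
  L^T = L /\ forall x : 'cV[R]_n, 0 <= (x^T *m L *m x) 0 0.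

Definition nonnegative_pair (R : realType) (n p : nat) (L : 'M[R]_n)
    (V : 'M[R]_(n, p)) : Prop :=
  [/\ L^T = L, \rank V = p &
      forall x : 'cV[R]_n, V^T *m x = 0 -> 0 <= (x^T *m L *m x) 0 0].

(* P(X = S) is proportional to w S when #|S| = m, and 0 otherwise; since the
   probabilities sum to 1, the constant c is the inverse of the sum of w. *)
Definition fixed_size_law (R : realType) (n m : nat) (w : {set 'I_n} -> R)
    (X : random_subset R n) : Prop :=
  exists c : R, forall S : {set 'I_n},
    pr_eq X S = if #|S| == m then c * w S else 0.

(* X ~ |DPP|_m(L) *)
Definition fixed_size_DPP (R : realType) (n m : nat) (L : 'M[R]_n)
    (X : random_subset R n) : Prop :=
  psd L /\ fixed_size_law m (fun S => \det (principal_submx S L)) X.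

(* X ~ |DPP|_m(L; V) *)
Definition fixed_size_ppDPP (R : realType) (n p m : nat) (L : 'M[R]_n)
    (V : 'M[R]_(n, p)) (X : random_subset R n) : Prop :=
  nonnegative_pair L V /\
  fixed_size_law m
    (fun S => (-1) ^+ p *
       \det (block_mx (principal_submx S L) (row_submx S V)
                      (row_submx S V)^T 0)) X.

(* Main.v *)
Require Import Defs.
From HB Require Import structures.
From mathcomp Require Import all_boot all_order all_algebra.
From mathcomp Require Import all_classical all_reals all_analysis.
From mathcomp Require Import ring.
Import Order.TTheory GRing.Theory Num.Theory.
Import numFieldNormedType.Exports.
Local Open Scope classical_set_scope.
Local Open Scope ring_scope.

(** Only ratios of the weights [det (L_e)_S] over the sets [S] of size [m]
    matter, so the law converges as soon as some power of [e] rescales the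
    weights to a limit that is not identically zero
    ([limit_fixed_size_law]).  Positivity of the limiting weights comes for
    free: they are, up to a common constant, limits of probabilities.

    With [U = V_{S,:}] and [B = A_S], the weight is [det (e B + U U^T)].  If
    [m <= p], nothing has to be rescaled and the limit is [det (U U^T)], which
    is nonzero when the [m] rows of [U] are independent.  If [m > p], every
    [U U^T] is singular, and the order of vanishing is read off the identity
    [det_perturbed_gram]:
      [det (e B + U U^T)
         = e ^ (m - p) (-1) ^ p det [[B, U], [U^T, - e]]],
    so that dividing by [e ^ (m - p)] gives in the limit the weight of the
    partial-projection process.

    What remains is to find one set [S] whose limiting weight is nonzero.  The
    bordered determinant [det [[B, U], [U^T, 0]]] is nonzero when [U] has full
    column rank and [B] is definite on [ker U^T] ([det_bordered_neq0]).  Full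
    column rank is obtained by letting [S] contain [p] independent rows of [V].
    Definiteness is where the invertibility of [A] enters: if [V^T x = 0] and
    [x^T A x = 0], then [x] is isotropic for the positive semi-definite [L_e],
    hence [0 = L_e x = e A x] and [x = 0]. *)

Set Implicit Arguments.
Unset Strict Implicit.
Unset Printing Implicit Defensive.

(** * Determinants of perturbed Gram matrices *)

(** The two factors come from multiplying the bordered matrix on the right by
    the lower triangular [[e, 0], [U^T, 1]], which clears its lower left block.
    No division is involved, so that [e] may be any scalar. *)
Lemma det_perturbed_bordered (R : comPzRingType) (k p : nat) (B : 'M[R]_k)
    (U : 'M[R]_(k, p)) (e : R) :
  \det (block_mx B U U^T (- e)%:M) * e ^+ k =
  \det (e *: B + U *m U^T) * (- e) ^+ p.
Proof.
have := congr1 determinant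
  (mulmx_block B U U^T (- e)%:M e%:M 0 U^T (1%:M : 'M[R]_p)).
rewrite det_mulmx det_lblock det1 mulr1 det_scalar => ->.
rewrite !mulmx1 !mulmx0 !add0r !mul_mx_scalar mul_scalar_mx scaleNr subrr.
by rewrite det_ublock det_scalar.
Qed.

(** The exact power of [e] that has to be divided out when [U U^T] is
    singular: the cofactor is a polynomial in [e] whose value at [0] is the
    bordered determinant with zero corner. *)
Lemma det_perturbed_gram (R : fieldType) (k p : nat) (B : 'M[R]_k)
    (U : 'M[R]_(k, p)) (e : R) : e != 0 -> (p <= k)%N ->
  \det (e *: B + U *m U^T) =
  e ^+ (k - p) * ((-1) ^+ p * \det (block_mx B U U^T (- e)%:M)).
Proof.
move=> e0 pk; apply: (mulIf (expf_neq0 p _ : (- e) ^+ p != 0)).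
  by rewrite oppr_eq0.
rewrite -det_perturbed_bordered (exprNn e).
have -> : e ^+ k = e ^+ (k - p) * e ^+ p by rewrite -exprD subnK.
have s1 : (-1) ^+ p * (-1) ^+ p = 1 :> R by rewrite -exprMn mulrNN mulr1 expr1n.
set s := (-1) ^+ p in s1 *; set d := \det _.
by rewrite -[LHS]mul1r -s1; ring.
Qed.

(** * Semi-definite forms *)

Lemma gram_eq0 (R : realDomainType) (n : nat) (x : 'cV[R]_n) :
  (x^T *m x) 0 0 = 0 -> x = 0.
Proof.
rewrite mxE => /eqP; rewrite psumr_eq0; last first.
  by move=> i _; rewrite mxE -expr2 sqr_ge0.
move=> /allP x0; apply/colP => i; rewrite mxE.
by have := x0 i (mem_index_enum _); rewrite mxE mulf_eq0 orbb => /eqP.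
Qed.

Lemma psd_gram (R : realType) (n p : nat) (V : 'M[R]_(n, p)) :
  psd (V *m V^T).
Proof.
split=> [|x]; first by rewrite trmx_mul trmxK.
rewrite mulmxA -mulmxA -{1}[V]trmxK -trmx_mul mxE.
by apply: sumr_ge0 => i _; rewrite mxE -expr2 sqr_ge0.
Qed.

(** Moving from [x] in the direction [y = L x] changes the form by
    [2 t (y^T y) + t ^ 2 (y^T L y)], which is negative for small [t < 0] unless
    [y = 0]. *)
Lemma psd_isotropic_ker (R : realType) (n : nat) (L : 'M[R]_n)
    (x : 'cV[R]_n) : psd L -> (x^T *m L *m x) 0 0 = 0 -> L *m x = 0.
Proof.
move=> [symL psdL] x0; apply: gram_eq0; apply/eqP.
set y := L *m x; set a := (y^T *m y) 0 0.
have a0 : 0 <= a.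
  by rewrite /a mxE sumr_ge0// => i _; rewrite mxE -expr2 sqr_ge0.
set b := (y^T *m L *m y) 0 0; have b0 : 0 <= b := psdL y.
have yLx : y^T *m L *m x = y^T *m y by rewrite /y !mulmxA.
have xLy : x^T *m L *m y = y^T *m y by rewrite /y trmx_mul symL.
have q t : ((x + t *: y)^T *m L *m (x + t *: y)) 0 0 = t * (a *+ 2 + t * b).
  have -> : (x + t *: y)^T = x^T + t *: y^T.
    by apply/rowP => i; rewrite !mxE.
  rewrite !mulmxDl !mulmxDr -!scalemxAl -!scalemxAr.
  have addE (M N : 'M[R]_1) : (M + N) 0 0 = M 0 0 + N 0 0 by rewrite mxE.
  have scaleE s (M : 'M[R]_1) : (s *: M) 0 0 = s * M 0 0 by rewrite mxE.
  by rewrite yLx xLy !(addE, scaleE) x0 -/a -/b; ring.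
rewrite eq_le a0 andbT leNgt; apply/negP => a1.
(* The denominator [b + 1] is positive even when [b = 0], and this step is
   still short enough for the linear term to dominate. *)
have := psdL (x + (- (a / (b + 1))) *: y); rewrite q leNgt => /negP; apply.
have b1 : 0 < b + 1 by rewrite ltr_wpDl.
rewrite mulNr oppr_lt0 mulr_gt0 ?divr_gt0// mulNr subr_gt0.
rewrite mulrAC ltr_pdivrMr//.
rewrite mulrDr mulr1 mulr2n mulrDl.
rewrite -subr_gt0.
have -> : a * b + a * b + (a + a) - a * b = a * b + (a + a).
  by rewrite addrAC addrK.
by rewrite ltr_wpDl ?mulr_ge0 ?addr_gt0// ltW.
Qed.

(** * Selecting rows *)

Lemma principal_submx_gram (R : realType) (n p : nat) (S : {set 'I_n})
    (V : 'M[R]_(n, p)) :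
  principal_submx S (V *m V^T) = row_submx S V *m (row_submx S V)^T.
Proof. by rewrite /principal_submx mxsub_mul trmx_mxsub. Qed.

Lemma principal_submx_perturbed (R : realType) (n p : nat) (S : {set 'I_n})
    (A : 'M[R]_n) (V : 'M[R]_(n, p)) (e : R) :
  principal_submx S (e *: A + V *m V^T) =
  e *: principal_submx S A + row_submx S V *m (row_submx S V)^T.
Proof. by rewrite -principal_submx_gram; apply/matrixP => i j; rewrite !mxE. Qed.

(** Restricting rows is left multiplication by [rowsub h 1%:M]; this partial
    isometry provides the one-sided inverse needed for rank arguments. *)
Lemma rowsub1_gram (R : nzRingType) (k n : nat) (h : 'I_k -> 'I_n) :
  injective h -> rowsub h 1%:M *m (rowsub h 1%:M)^T = 1%:M :> 'M[R]_k.
Proof.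
move=> hI; rewrite trmx_mxsub trmx1 -mxsub_mul mul1mx.
by apply/matrixP => i j; rewrite !mxE (inj_eq hI).
Qed.

Lemma exists_subset_card (T : finType) (B : {set T}) (k : nat) :
  (k <= #|B|)%N -> exists2 S : {set T}, S \subset B & #|S| = k.
Proof.
rewrite -bin_gt0 -cards_draws card_gt0 => /set0Pn[S].
by rewrite inE => /andP[SB /eqP]; exists S.
Qed.

(** [V] has [p] rows forming an invertible matrix, and any [m] of them are
    independent. *)
Lemma exists_row_free_submx (R : realType) (n p m : nat) (V : 'M[R]_(n, p)) :
  \rank V = p -> (m <= p)%N ->
  exists2 S : {set 'I_n}, #|S| = m & row_free (row_submx S V).
Proof.
move=> rV mp; have fV : row_full V by rewrite /row_full rV.
set f := fullrankfun fV; have fI : injective f := fullrankfun_inj (rkA := fV).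
have mT : (m <= #|[set: 'I_p]%SET|)%N by rewrite cardsT card_ord.
have [J _ cJ] := exists_subset_card mT.
exists (f @: J); first by rewrite card_imset// cJ; exact: cJ.
(* The rows of the submatrix are listed in increasing order, not in the order
   of [f], so [h] is the reindexing between the two. *)
have /fin_all_exists[h hE] (i : 'I_#|f @: J|) : exists j, enum_val i = f j.
  by have /imsetP[j _ ->] := enum_valP i; exists j.
have hI : injective h.
  by move=> i j hij; apply: enum_val_inj; rewrite !hE hij.
rewrite /row_submx (eq_rowsub (f \o h)) // rowsub_comp rowsubE.
rewrite /row_free mxrankMfree ?fullrowsub_free//.
by apply/row_freeP; exists (rowsub h 1%:M)^T; rewrite rowsub1_gram.
Qed.

(** Enlarging a set of [p] independent rows by arbitrary other rows keeps the
    column rank. *)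
Lemma exists_row_full_submx (R : realType) (n p m : nat) (V : 'M[R]_(n, p)) :
  \rank V = p -> (p <= m <= n)%N ->
  exists2 S : {set 'I_n}, #|S| = m & row_full (row_submx S V).
Proof.
move=> rV /andP[pm mn]; have fV : row_full V by rewrite /row_full rV.
set f := fullrankfun fV; have fI : injective f := fullrankfun_inj (rkA := fV).
pose T := f @: [set: 'I_p]%SET.
have cT : #|T| = p by rewrite card_imset// cardsT card_ord.
have mT : (m - p <= #|~: T|)%N.
  by rewrite cardsCs finset.setCK cT card_ord leq_sub2r.
have [S' S'T cS'] := exists_subset_card mT.
have TS' : (T :&: S')%SET = finset.set0.
  by apply/eqP; rewrite finset.setIC finset.setI_eq0 finset.disjoints_subset.
exists (T :|: S')%SET; first by rewrite cardsU TS' cards0 subn0 cT cS' subnKC.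
rewrite /row_full eqn_leq rank_leq_col /= -[X in (X <= _)%N](eqP (fullrowsub_full fV)).
apply/mxrankS/row_subP => i.
have fiS : f i \in (T :|: S')%SET by rewrite inE imset_f.
rewrite row_rowsub -(enum_rankK_in fiS fiS).
by rewrite -row_rowsub row_sub.
Qed.

(** * Nonvanishing of the limiting weights *)

(** If [x U U^T = 0], then [x U] has norm zero. *)
Lemma det_gram_neq0 (R : realFieldType) (k p : nat) (U : 'M[R]_(k, p)) :
  row_free U -> \det (U *m U^T) != 0.
Proof.
move=> fU; apply/negP => /det0P[x /negP x0 xU]; apply: x0.
rewrite -(mulmx_free_eq0 x fU) -trmx_eq0; apply/eqP/gram_eq0.
by rewrite trmxK trmx_mul mulmxA -(mulmxA x) xU mul0mx mxE.
Qed.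

(** For [(x, y)] in the left kernel, [x U = 0] and [x B = - y U^T], whence
    [x B x^T = - y (x U)^T = 0] and [x = 0]; then [y U^T = 0] and the full
    column rank of [U] gives [y = 0]. *)
Lemma det_bordered_neq0 (R : fieldType) (k p : nat) (B : 'M[R]_k)
    (U : 'M[R]_(k, p)) : row_full U ->
  (forall x : 'rV_k, x *m U = 0 -> (x *m B *m x^T) 0 0 = 0 -> x = 0) ->
  \det (block_mx B U U^T 0) != 0.
Proof.
move=> fU posB; apply/negP => /det0P[z /negP z0 zM]; apply: z0.
move: zM; rewrite -[z]hsubmxK mul_row_block -row_mx0 mulmx0 addr0.
set x := lsubmx z; set y := rsubmx z => /eq_row_mx[xB xU].
have x0 : x = 0.
  apply: posB => //; move/eqP: xB; rewrite addr_eq0 => /eqP ->.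
  by rewrite mulNmx -mulmxA -trmx_mul xU trmx0 mulmx0 oppr0 mxE.
move: xB; rewrite x0 mul0mx add0r => /eqP.
rewrite mulmx_free_eq0; last by rewrite /row_free mxrank_tr.
by move=> /eqP ->; rewrite row_mx0.
Qed.

(** The form of a principal submatrix at [x] is the form of the whole matrix at
    the extension of [x] by zero. *)
Lemma principal_submx_form (R : realType) (n : nat) (S : {set 'I_n})
    (M : 'M[R]_n) (x : 'rV[R]_#|S|) :
  let xS := (x *m row_submx S 1%:M)^T in
  x *m principal_submx S M *m x^T = xS^T *m M *m xS.
Proof.
rewrite /= trmxK trmx_mul !mulmxA; congr (_ *m _).
rewrite -!mulmxA; congr (x *m _).
by rewrite trmx_mxsub trmx1 mulmxA -!rowsubE -mxsub_mul mulmx1.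
Qed.

(** Extension by zero maps the kernel of [V_{S,:}^T] into that of [V^T], so
    definiteness on the latter passes to every principal submatrix. *)
Lemma det_ppDPP_weight_neq0 (R : realType) (n p : nat) (A : 'M[R]_n)
    (V : 'M[R]_(n, p)) (S : {set 'I_n}) :
  (forall x : 'cV_n, V^T *m x = 0 -> (x^T *m A *m x) 0 0 = 0 -> x = 0) ->
  row_full (row_submx S V) ->
  \det (block_mx (principal_submx S A) (row_submx S V) (row_submx S V)^T 0) != 0.
Proof.
move=> posA fS; apply: det_bordered_neq0 => // x xV.
rewrite principal_submx_form => xA.
have fE : row_free (row_submx S 1%:M : 'M[R]_(#|S|, n)).
  apply/row_freeP; exists (row_submx S 1%:M)^T.
  by rewrite rowsub1_gram//; exact: enum_val_inj.
apply/eqP; rewrite -(mulmx_free_eq0 x fE) -trmx_eq0; apply/eqP/posA => //.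
by rewrite -trmx_mul -mulmxA -rowsubE xV trmx0.
Qed.

(** * Convergence of the weights *)

(** The determinant is a polynomial in [e], hence continuous. *)
Lemma cvg_det_perturbed (R : realType) (k : nat) (B C : 'M[R]_k) :
  \det (B + e *: C) @[e --> 0^'+] --> \det B.
Proof.
pose P := \det (map_mx polyC B + 'X *: map_mx polyC C).
have PE e : P.[e] = \det (B + e *: C).
  rewrite -[LHS]/(horner_eval e P) -det_map_mx; congr (\det _).
  by apply/matrixP => i j; rewrite !mxE /= /horner_eval !hornerE.
have -> : (fun e => \det (B + e *: C)) = horner P by apply/funext => e; rewrite PE.
have -> : \det B = P.[0] by rewrite PE scale0r addr0.
by apply: cvg_at_right_filter; exact: continuous_horner.
Qed.

Lemma bordered_perturbed (R : pzRingType) (k p : nat) (B : 'M[R]_k)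
    (U : 'M[R]_(k, p)) (e : R) :
  block_mx B U U^T (- e)%:M =
  block_mx B U U^T 0 + e *: block_mx 0 0 0 (- 1%:M).
Proof.
by rewrite scale_block_mx add_block_mx !scaler0 !addr0 add0r scalerN -scaleNr
  scalemx1.
Qed.

(** * Random subsets with a prescribed law *)

Section finite_law.
Variables (R : realType) (n : nat) (q : {set 'I_n} -> {nonneg R}).

(** The sample space is [nat], because all its subsets are measurable; the
    sample [i] stands for the subset of rank [i] in the enumeration. *)
Definition finite_law : set nat -> \bar R :=
  msum (fun i => mscale (q (nth finset.set0 (enum {set 'I_n}) i)) \d_i)
       #|{set 'I_n}|.

HB.instance Definition _ := Measure.on finite_law.

Lemma finite_lawE (B : set nat) :
  finite_law B =
  (\sum_(S : {set 'I_n}) (q S)%:num * \1_B (enum_rank S : nat))%:E.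
Proof.
rewrite /finite_law /msum /= (reindex (@enum_rank {set 'I_n})) /=; last first.
  by apply: onW_bij; exact: enum_rank_bij.
rewrite -sumEFin; apply: eq_bigr => S _.
by rewrite /mscale /= diracE nth_enum_rank indicE.
Qed.

Hypothesis q1 : \sum_(S : {set 'I_n}) (q S)%:num = 1.

Lemma finite_law_setT : finite_law setT = 1%E.
Proof.
rewrite finite_lawE -[RHS]/(1%:E) -q1; congr EFin; apply: eq_bigr => S _.
by rewrite indicT mulr1.
Qed.

HB.instance Definition _ :=
  Measure_isProbability.Build _ _ _ finite_law finite_law_setT.

Definition finite_random_subset : random_subset R n :=
  @RandomSubset R n _ nat finite_law
    (nth finset.set0 (enum {set 'I_n})) (fun _ => I).

Lemma pr_eq_finite_random_subset S : pr_eq finite_random_subset S = (q S)%:num.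
Proof.
rewrite /pr_eq /= finite_lawE /= (bigD1 S) //= big1 => [|S' S'S].
  by rewrite indicE mem_set /= ?nth_enum_rank// mulr1 addr0.
by rewrite indicE memNset /= ?nth_enum_rank ?mulr0//; apply/eqP.
Qed.

End finite_law.

Lemma exists_random_subset (R : realType) (n : nat) (q : {set 'I_n} -> R) :
  (forall S, 0 <= q S) -> \sum_S q S = 1 ->
  exists X : random_subset R n, forall S, pr_eq X S = q S.
Proof.
move=> q0 q1; pose q' S := NngNum (q0 S).
exists (@finite_random_subset R n q' q1) => S.
by rewrite pr_eq_finite_random_subset.
Qed.

Lemma pr_eq_ge0 (R : realType) (n : nat) (X : random_subset R n) S :
  0 <= pr_eq X S.
Proof. by apply: fine_ge0; exact: measure_ge0. Qed.

(** The events [X = S] partition the sample space. *)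
Lemma sum_pr_eq (R : realType) (n : nat) (X : random_subset R n) :
  \sum_S pr_eq X S = 1.
Proof.
rewrite sum_fine => [|S _]; last first.
  by apply: fin_num_measure; exact: rs_measurable.
rewrite -[RHS]/(fine 1%E) -(probability_setT (rs_prob X)); congr fine.
have -> : [set: rs_space X] = \bigcup_(S in [set: {set 'I_n}]) (X @^-1` [set S]).
  by apply/seteqP; split=> // x _; exists (X x).
rewrite measure_fin_bigcup; first last.
- by move=> S _; exact: rs_measurable.
- by move=> S S' _ _ [x [/= <- <-]].
- exact: finite_finset.
rewrite (@fsbigE _ _ _ _ _ (index_enum {set 'I_n}))//=.
- by apply: eq_bigl => S; rewrite in_setT.
- exact: index_enum_uniq.
- by move=> S _; rewrite mem_index_enum.
Qed.

(** * Convergence of fixed-size laws *)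

(** The limit of the weights at a single [S0] controls their total mass: since
    the [c * w e S] are probabilities, the weights of sets of size [m] all have
    the same sign, so the absolute value of their sum is at least that of any
    one of them.  The normalization therefore does not degenerate, and the
    nonnegativity of [v / Z] is inherited from the probabilities. *)
Lemma limit_fixed_size_law (R : realType) (n m : nat)
    (X : R -> random_subset R n) (w : R -> {set 'I_n} -> R)
    (v : {set 'I_n} -> R) (S0 : {set 'I_n}) :
  (\forall e \near 0^'+, fixed_size_law m (w e) (X e)) ->
  (forall S : {set 'I_n}, #|S| = m -> w e S @[e --> 0^'+] --> v S) ->
  #|S0| = m -> v S0 != 0 ->
  exists Xstar : random_subset R n,
    fixed_size_law m v Xstar /\ converges_in_law X Xstar.
Proof.
move=> lawX wv cS0 vS0.
pose W e := \sum_(S : {set 'I_n} | #|S| == m) w e S.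
pose Z := \sum_(S : {set 'I_n} | #|S| == m) v S.
have law1 e : fixed_size_law m (w e) (X e) -> exists2 c,
    c * W e = 1 & forall S, pr_eq (X e) S = if #|S| == m then c * w e S else 0.
  move=> [c cw]; exists c => //; rewrite -(sum_pr_eq (X e)).
  rewrite (eq_bigr _ (fun S _ => cw S)).
  by rewrite -big_mkcond mulr_sumr.
have WZ : W e @[e --> 0^'+] --> Z.
  by apply: cvg_big => [|S /eqP]; [exact: add_continuous | exact: wv].
have absW : \forall e \near 0^'+, `|w e S0| <= `|W e|.
  apply: filterS lawX => e /law1[c cW cw].
  have c0 : 0 < `|c|.
    rewrite normr_gt0; apply: contra_eq_neq cW => ->.
    by rewrite mul0r eq_sym oner_neq0.
  have cw0 (S : {set 'I_n}) : #|S| == m -> 0 <= c * w e S.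
    by move=> cS; have := pr_eq_ge0 (X e) S; rewrite cw cS.
  rewrite -(ler_pM2l c0) -!normrM cW normr1 ger0_norm; last first.
    by apply: cw0; rewrite cS0.
  rewrite -cW mulr_sumr (bigD1 S0) ?cS0//= lerDl sumr_ge0// => S /andP[+ _].
  exact: cw0.
have Z0 : Z != 0.
  rewrite -normr_gt0 (lt_le_trans _ (_ : `|v S0| <= _)) ?normr_gt0//.
  by apply: ler_cvg_to absW; apply: cvg_norm => //; exact: wv.
pose q (S : {set 'I_n}) := if #|S| == m then Z^-1 * v S else 0.
have prq S : pr_eq (X e) S @[e --> 0^'+] --> q S.
  apply: (@cvg_trans _ ((if #|S| == m then (W e)^-1 * w e S else 0) @[e --> 0^'+])).
    apply: near_eq_cvg; apply: filterS lawX => e /law1[c cW ->].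
    case: ifP => // _; congr (_ * _).
    have W0 : W e != 0.
      by apply: contra_eq_neq cW => ->; rewrite mulr0 eq_sym oner_neq0.
    by apply: (mulIf W0); rewrite mulVf.
  rewrite /q; case: ifP => [/eqP cS|_]; last exact: cvg_cst.
  by apply: cvgM; [exact: cvgV | exact: wv].
have q_ge0 S : 0 <= q S.
  by apply: cvgr_to_ge (prq S) _; apply: nearW => e; exact: pr_eq_ge0.
have q1 : \sum_S q S = 1 by rewrite -big_mkcond -mulr_sumr mulVf.
have [Xs Xsq] := exists_random_subset q_ge0 q1.
exists Xs; split; first by exists Z^-1.
by move=> S; rewrite Xsq.
Qed.

(** * The small-perturbation limit *)

Unset Implicit Arguments.

Theorem theorem3p1 (R : realType) (n p m : nat)
    (V : 'M[R]_(n, p)) (A : 'M[R]_n) (X : R -> random_subset R n)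
    (rankV : \rank V = p) (ltpn : (p < n)%N)
    (symA : A^T = A) (rankA : \rank A = n)
    (psdL : \forall e \near 0^'+, psd (e *: A + V *m V^T))
    (hm : (1 <= m <= n)%N)
    (lawX : \forall e \near 0^'+, fixed_size_DPP m (e *: A + V *m V^T) (X e)) :
  exists Xstar : random_subset R n,
    (if (m <= p)%N then fixed_size_DPP m (V *m V^T) Xstar
     else fixed_size_ppDPP m A V Xstar) /\
    converges_in_law X Xstar.
Proof.
have [e [e0 psde]] : exists e : R, 0 < e /\ psd (e *: A + V *m V^T).
  near (0 : R)^'+ => e; exists e; split; near: e => //; exact: nbhs_right_gt.
have formV (x : 'cV_n) : V^T *m x = 0 ->
    (x^T *m (e *: A + V *m V^T) *m x) 0 0 = e * (x^T *m A *m x) 0 0.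
  move=> Vx; rewrite mulmxDr mulmxDl -scalemxAr -scalemxAl mulmxA.
  by rewrite -(mulmxA _ V^T) Vx mulmx0 addr0 mxE.
have nonnegA (x : 'cV_n) : V^T *m x = 0 -> 0 <= (x^T *m A *m x) 0 0.
  by move=> Vx; rewrite -(pmulr_rge0 _ e0) -formV//; exact: psde.2.
have posA (x : 'cV_n) : V^T *m x = 0 -> (x^T *m A *m x) 0 0 = 0 -> x = 0.
  move=> Vx xA; have := psd_isotropic_ker psde.
  move=> /(_ x); rewrite formV// xA mulr0 => /(_ erefl).
  rewrite mulmxDl -mulmxA Vx mulmx0 addr0 -scalemxAl => /eqP.
  rewrite scaler_eq0 gt_eqF//= => /eqP Ax.
  apply: trmx_inj; apply/eqP; rewrite trmx0.
  have fA : row_free A by rewrite /row_free rankA.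
  by rewrite -(mulmx_free_eq0 _ fA) -{1}symA -trmx_mul Ax trmx0.
have [mp|pm] := leqP m p.
  have [S0 cS0 fS0] := exists_row_free_submx rankV mp.
  have [||||Xs [lawXs cvX]] := @limit_fixed_size_law R n m X
    (fun e S => \det (principal_submx S (e *: A + V *m V^T)))
    (fun S => \det (principal_submx S (V *m V^T))) S0 => //.
  - by apply: filterS lawX => ? [].
  - move=> S _; rewrite principal_submx_gram.
    under eq_cvg do rewrite principal_submx_perturbed addrC.
    exact: cvg_det_perturbed.
  - by rewrite principal_submx_gram; exact: det_gram_neq0.
  by exists Xs; split=> //; split=> //; exact: psd_gram.
have [S0 cS0 fS0] : exists2 S : {set 'I_n}, #|S| = m & row_full (row_submx S V).
  by apply: exists_row_full_submx => //; rewrite ltnW//; case/andP: hm.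
pose D S (d : 'M[R]_p) : R := (-1) ^+ p *
  \det (block_mx (principal_submx S A) (row_submx S V) (row_submx S V)^T d).
have [||||Xs [lawXs cvX]] := @limit_fixed_size_law R n m X
  (fun e S => D S (- e)%:M) (fun S => D S 0) S0 => //.
- near=> t; have t0 : t != 0 by rewrite gt_eqF//; near: t; exact: nbhs_right_gt.
  have [_ [c cX]] : fixed_size_DPP m (t *: A + V *m V^T) (X t) by near: t.
  (* The power of [t] dividing the weights goes into the normalization. *)
  exists (c * t ^+ (m - p)) => S; rewrite cX; case: eqP => // cS.
  have pS : (p <= #|S|)%N by rewrite cS ltnW.
  by rewrite principal_submx_perturbed det_perturbed_gram// mulrA -cS.
- move=> S _; apply: cvgM; first exact: cvg_cst.
  under eq_cvg do rewrite bordered_perturbed.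
  exact: cvg_det_perturbed.
- by rewrite mulf_neq0 ?signr_eq0// det_ppDPP_weight_neq0.
exists Xs; split=> //; split=> //; split=> //.
Unshelve. all: by end_near.
Qed.
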